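(* Let $p$ be a Mersenne prime. Then there exists a finite solvable group $G$ with $b(G) = p^p$ and $|G : O_p(G)|_p = p^{p+1}$. In particular, for this $G$, $|G : O_p(G)|_p = \left( b(G)^p/p \right)^{1/(p-1)}$.
   Context: All groups are finite. $\mathrm{Irr}(G)$ is the set of irreducible complex characters of $G$, and $b(G) = \max\{\chi(1) \mid \chi \in \mathrm{Irr}(G)\}$ is the largest irreducible character degree of $G$. $O_p(G)$ is the largest normal $p$-subgroup of $G$. For a positive integer $m$, $m_p$ is the largest power of $p$ dividing $m$; thus $|G:O_p(G)|_p$ is the $p$-part of the index. A Mersenne prime is a prime of the form $2^f - 1$ with $f$ a positive integer. *)

(* Defs.v *)
From mathcomp Require Import all_boot all_order all_algebra all_fingroup.
From mathcomp Require Import all_solvable all_field all_character.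

Set Implicit Arguments.
Unset Strict Implicit.
Unset Printing Implicit Defensive.

Definition mersenne_prime (p : nat) : Prop :=
  prime p /\ exists2 f : nat, 0 < f & p = 2 ^ f - 1.

(* Character values live in algC; degrees are natural numbers ([Cnat_irr1]), so
   [Num.truncn] merely reads 'chi_i(1) as an element of nat. *)
Definition max_irr_degree (gT : finGroupType) (G : {group gT}) : nat :=
  \max_(i : Iirr G) Num.truncn ('chi[G]_i 1%g).

(* Main.v *)
Require Import Defs.
From mathcomp Require Import all_boot all_order all_algebra all_fingroup.
From mathcomp Require Import all_solvable all_field all_character.
From mathcomp Require Import zify.
Import Num.Theory.

(** Write $p = 2^f - 1$ and let $F$ be the field with $p + 1$ elements.  The
    group is the wreath product of $F \rtimes F^\times$ with the cyclic group
    of order $p$, realized as the group $G$ of all permutations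
    $x \mapsto (a_i x_{i+k} + b_i)_i$ of $F^p$, with the indices $i$ taken
    modulo $p$.  Let $V \cong F^p$ be its translation subgroup: it is normal
    and abelian, it has order $(p+1)^p$, prime to $p$, and index $p^{p+1}$.

    The subgroup $O_p(G)$ meets the normal $p'$-subgroup $V$ trivially, hence
    centralizes it; but $V$ is regular and abelian, so it is its own
    centralizer, and $O_p(G) = 1$ ([pcore_self_centralizing],
    [cent_tr_group]).  This gives the index.

    Degrees are at most $p^p$ for a numerical reason ([irr1_mul_prime_leq]).
    There are only $|V| = (p+1)^p < p^{p+1} = |G : V|$ irreducible characters
    of $V$, so none of them has an orbit of length $|G : V|$ under $G$, and each
    $\lambda$ is invariant in some $A > V$ with $|A : V| = p$.  Every
    irreducible character of $A$ over an invariant linear $\lambda$ is linear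
    ([irr1_invariant_prime_index]), so an irreducible character of $G$ over
    $\lambda$ is a constituent of a character of degree $|G : A| = p^p$.

    The degree $p^p$ is reached because some $\lambda$ is fixed by no nontrivial
    element of the group $D \cong (F^\times)^p$ of diagonal maps, of order
    $p^p$: its orbit then has length at least $p^p$ ([irr1_geq_card]).  Such a
    $\lambda$ is any nontrivial character of $V$ that is trivial on the vectors
    of coordinate sum zero, that is $b \mapsto \psi(\sum_i b_i)$ with
    $\psi \neq 1$ ([diag_inertia]). *)

(** * Orders, cores and degrees over an abelian normal subgroup *)

Lemma expSn_ltn n : 2 < n -> n.+1 ^ n < n ^ n.+1.
Proof.
elim: n => // n IHn; rewrite ltnS leq_eqVlt.
case/predU1P=> [<- // | /[dup] n_gt2 /IHn{}IHn].
(* The step multiplies the hypothesis by (n (n+2))^(n+1) <= (n+1)^(2n+2). *)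
rewrite -(@ltn_pmul2r (n ^ n.+1)) ?expn_gt0 ?(ltnW (ltnW n_gt2)) // -expnMn.
apply: (@leq_ltn_trans ((n.+1 * n.+1) ^ n.+1)); first by rewrite leq_exp2r //; lia.
rewrite expnMn -expnD (_ : n.+1 + n.+1 = n.+2 + n)%N; last by lia.
by rewrite expnD ltn_pmul2l ?expn_gt0.
Qed.

Section NormalSubgroup.
Set Implicit Arguments.
Unset Strict Implicit.
Unset Printing Implicit Defensive.
Import GRing.Theory GroupScope.
Local Open Scope ring_scope.

(** The p-core and V are normal of coprime orders, so they commute: the p-core
    lies in 'C(V), hence in V, where its order leaves no room for it. *)
Lemma pcore_self_centralizing (gT : finGroupType) (G V : {group gT}) p :
  V <| G -> p^'.-group V -> 'C(V) \subset V -> 'O_p(G) = 1%g.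
Proof.
move=> nsVG p'V cVV; have pO := pcore_pgroup p G.
have tiOV : 'O_p(G) :&: V = 1%g := coprime_TIg (pnat_coprime pO p'V).
apply/trivgP; rewrite -tiOV subsetIidl (subset_trans _ cVV) //.
apply/commG1P/trivgP; rewrite -tiOV commg_subI // subsetI subxx.
  by rewrite (subset_trans (pcore_sub _ _)) ?normal_norm.
by rewrite (subset_trans (normal_sub nsVG)) ?gFnorm.
Qed.

(** By Frobenius reciprocity the multiplicity of 'chi_j in 'chi_i is the inner
    product of 'Res[A] 'chi_i and 'Ind[A] 'chi_j, so these two characters share
    a constituent. *)
Lemma constt_Res_between (gT : finGroupType) (G A V : {group gT})
    (i : Iirr G) (j : Iirr V) :
    V \subset A -> A \subset G -> j \in irr_constt ('Res[V] 'chi_i) ->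
  exists2 k, k \in irr_constt ('Res[A] 'chi_i)
           & j \in irr_constt ('Res[V] 'chi_k).
Proof.
move=> sVA sAG; rewrite -(cfResRes 'chi_i sVA sAG) irr_consttE cfdot_Res_l.
rewrite cfdot_sum_irr => nz.
have [k /andP[ki kj]|no] := pickP [pred k | (k \in irr_constt ('Res[A] 'chi_i))
   && (k \in irr_constt ('Ind[A] 'chi_j))].
  by exists k; rewrite // -constt_Ind_Res.
case/eqP: nz; apply: big1 => k _; apply/eqP; rewrite mulf_eq0 conjC_eq0.
by have:= no k; rewrite /= !irr_consttE -negb_or => /negbFE.
Qed.

(** By Clifford's theorem 'chi_k restricts to a multiple of the linear 'chi_j, so
    V acts by scalars and lies in the center of 'chi_k.  As A / V is abelian, the
    square of the degree is the index of that center, a divisor of the prime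
    p. *)
Lemma irr1_invariant_prime_index (gT : finGroupType) (A V : {group gT}) p
    (k : Iirr A) (j : Iirr V) :
    prime p -> abelian V -> V <| A -> #|A : V| = p -> A \subset 'I['chi_j] ->
  j \in irr_constt ('Res[V] 'chi_k) -> 'chi_k 1%g = 1.
Proof.
move=> p_pr abV nsVA iAV sAI kj; have [sVA nVA] := andP nsVA.
have linj : 'chi_j \is a linear_char by apply/char_abelianP.
have sVZ : V \subset 'Z('chi_k)%CF.
  apply/subsetP=> v Vv; have Av := subsetP sVA v Vv.
  have eE x : x \in V ->
      ('chi_k x = '['Res[V] 'chi_k, 'chi_j] * 'chi_j x).
    move=> Vx; rewrite -(cfResE _ sVA) // {1}(Clifford_Res_sum_cfclass nsVA kj).
    by rewrite cfclass_invariant // big_seq1 cfunE.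
  rewrite irr_cfcenterE // !eE // lin_char1 // normrM normC_lin_char //.
  rewrite !mulr1 ger0_norm // natr_ge0 // Cnat_cfdot_char ?irr_char //.
  by rewrite cfRes_char ?irr_char.
have abAV : abelian (A / V)%g.
  by rewrite cyclic_abelian // prime_cyclic // card_quotient // iAV.
have abAZ : abelian (A / 'Z('chi_k)%CF)%g.
  rewrite sub_der1_abelian // (subset_trans _ sVZ) //.
  by rewrite der1_min.
have /(congr1 Num.truncn) := irr1_abelian_bound abAZ.
have /natrP[n chi1] := Cnat_irr1 k; rewrite chi1 -natrX !natrK => n2E.
suff -> : n = 1%N by [].
have n2p : (n ^ 2 %| p)%N by rewrite n2E -iAV indexgS.
have /primeP[p_gt1 p_dv] := p_pr.
have n_p : (n %| p)%N by apply: dvdn_trans n2p; rewrite dvdn_mulr.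
have /pred2P[-> //|nE] := p_dv n n_p.
by have := dvdn_leq (prime_gt0 p_pr) n2p; rewrite nE -{2}[p]expn1 leq_exp2l.
Qed.

(** The G-orbit of a constituent of 'Res[V] 'chi_i has length at most
    #|Irr V| = #|V| < #|G : V|, so its inertia group T properly contains V, and
    Cauchy's theorem in T / V gives V < A <= T with #|A : V| = p.  A character of
    A over that constituent is linear, and inducing it to G bounds the degree of
    'chi_i by #|G : A|. *)
Lemma irr1_mul_prime_leq (gT : finGroupType) (G V : {group gT}) p (i : Iirr G) :
    prime p -> abelian V -> V <| G -> p.-nat #|G : V| -> (#|V| < #|G : V|)%N ->
  'chi_i 1%g * p%:R <= #|G : V|%:R.
Proof.
move=> p_pr abV nsVG pGV ltVGV; have [sVG nVG] := andP nsVG.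
have [j ij] := constt_cfRes_irr V i.
set T := 'I_G['chi_j]%G.
have sVT : V \subset T by rewrite sub_Inertia.
have nVT : T \subset 'N(V) by rewrite (subset_trans (Inertia_sub _ _)).
have iGT : (#|G : T| <= #|V|)%N.
  by rewrite -card_cfclass_Iirr // -(card_Iirr_abelian abV) max_card.
have : (p %| #|(T / V)%g|)%N.
  rewrite card_quotient //.
  have pTV : p.-nat #|T : V|.
    by apply: pnat_dvd pGV; rewrite indexSg // Inertia_sub.
  case/p_natP: pTV => [[|m] oTV]; last by rewrite oTV expnS dvdn_mulr.
  have defT := index1g sVT oTV; move: iGT.
  by rewrite -[gval T]defT leqNgt ltVGV.
case/(Cauchy p_pr)=> xb Txb oxb.
have sxT : <[xb]> \subset (T / V)%g by rewrite cycle_subG.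
have [A defA sVA sAT] := inv_quotientS (normal_Inertia _ sVG) sxT.
have sAG : A \subset G := subset_trans sAT (Inertia_sub _ _).
have nVA : A \subset 'N(V) := subset_trans sAG nVG.
have iAV : #|A : V| = p by rewrite -card_quotient // -defA -orderE.
have [k ik kj] := constt_Res_between sVA sAG ij.
have chik1 : 'chi_k 1%g = 1.
  apply: (irr1_invariant_prime_index p_pr abV _ iAV _ kj).
    by rewrite /normal sVA.
  by rewrite (subset_trans sAT) ?subsetIr.
have -> : #|G : V|%:R = #|G : A|%:R * p%:R :> algC.
  by rewrite -natrM -iAV Lagrange_index.
rewrite ler_wpM2r ?ler0n //.
rewrite -constt_Ind_Res in ik.
have := char1_ge_constt _ ik; rewrite cfInd1 // chik1 mulr1; apply.
by rewrite cfInd_char ?irr_char.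
Qed.

(** The orbit of 'chi_j has at least #|D| elements, as D meets its stabilizer
    trivially, and by the Clifford
    correspondence an irreducible character over 'chi_j has degree divisible by
    the length of that orbit. *)
Lemma irr1_geq_card (gT : finGroupType) (G V D : {group gT}) (j : Iirr V) :
    V <| G -> D \subset G -> D :&: 'I['chi_j] = 1%g ->
  exists i : Iirr G, #|D|%:R <= 'chi_i 1%g.
Proof.
move=> nsVG sDG tiDI; have [sVG nVG] := andP nsVG.
set T := 'I_G['chi_j]%G.
have leDT : (#|D| <= #|G : T|)%N.
  rewrite -(@leq_pmul2l #|T|) // Lagrange ?Inertia_sub // mulnC -TI_cardMg.
    by rewrite subset_leq_card // mul_subG // Inertia_sub.
  by rewrite /= setIA (setIidPl sDG).
have [sch _ _ _ _] := constt_Inertia_bijection j nsVG.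
have [s sP] := constt_cfInd_irr j (sub_Inertia 'chi_j sVG).
have /irrP[i iE] := sch s sP; exists i; rewrite -iE cfInd1 ?Inertia_sub //.
have /natrP[n n1] := Cnat_irr1 s; have := irr1_gt0 s.
rewrite n1 ltr0n -natrM ler_nat => n_gt0.
by rewrite (leq_trans leDT) // leq_pmulr.
Qed.

Lemma proper_sub_cfker_irr (gT : finGroupType) (V W : {group gT}) :
  W <| V -> ~~ (V \subset W) -> exists2 j : Iirr V, j != 0 & W \subset cfker 'chi_j.
Proof.
move=> nsWV nsVW; have [sWV nWV] := andP nsWV.
have /has_nonprincipal_irr[i nzi] : (V / W != 1)%g by rewrite -subG1 quotient_sub1.
exists (mod_Iirr i); first by rewrite mod_Iirr_eq0.
by rewrite mod_IirrE // cfker_mod.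
Qed.

(** The two degree bounds together: counting the characters of V limits every
    degree, and the subgroup D shows that the limit is attained. *)
Lemma max_irr_degree_eq (gT : finGroupType) (G V D : {group gT}) p n (j : Iirr V) :
    prime p -> abelian V -> V <| G -> #|G : V| = (p ^ n.+1)%N ->
    (#|V| < p ^ n.+1)%N -> D \subset G -> #|D| = (p ^ n)%N ->
    D :&: 'I['chi_j] = 1%g ->
  max_irr_degree G = (p ^ n)%N.
Proof.
move=> p_pr abV nsVG iGV ltV sDG oD tiDI; have p_gt0 := prime_gt0 p_pr.
apply/eqP; rewrite eqn_leq; apply/andP; split.
  apply/bigmax_leqP=> i _; have /natrP[m m1] := Cnat_irr1 i.
  have := irr1_mul_prime_leq i p_pr abV nsVG.
  rewrite m1 natrK iGV pnatX pnat_id // => /(_ isT ltV).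
  by rewrite -natrM ler_nat expnSr leq_pmul2r.
have [i] := irr1_geq_card nsVG sDG tiDI.
have /natrP[m m1] := Cnat_irr1 i; rewrite m1 ler_nat oD => le_m.
by rewrite (leq_trans le_m) // -[m](@natrK algC) -m1; apply: leq_bigmax.
Qed.

End NormalSubgroup.

(** * The affine group of F^I with monomial linear part *)

Section AffineWreath.
Set Implicit Arguments.
Unset Strict Implicit.
Unset Printing Implicit Defensive.
Import GRing.Theory GroupScope.
Local Open Scope ring_scope.

Variables (F : finFieldType) (I : finZmodType).
Implicit Types (a : {ffun I -> {unit F}}) (k : I) (b x : {ffun I -> F}).

Definition aff_fun b a k x : {ffun I -> F} :=
  [ffun i => FinRing.uval (a i) * x (i + k) + b i].

Lemma aff_fun_inj b a k : injective (aff_fun b a k).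
Proof.
move=> x y /ffunP exy; apply/ffunP=> i; have:= exy (i - k).
by rewrite !ffunE subrK => /addIr/(mulrI (valP (a _))).
Qed.

Definition aff b a k : {perm {ffun I -> F}} := perm (@aff_fun_inj b a k).

Lemma affE b a k x i :
  aff b a k x i = FinRing.uval (a i) * x (i + k) + b i.
Proof. by rewrite permE ffunE. Qed.

Lemma affM b a k b' a' k' :
  (aff b a k * aff b' a' k')%g =
  aff [ffun i => FinRing.uval (a' i) * b (i + k') + b' i]
      [ffun i => a' i * a (i + k')]%g (k' + k).
Proof.
apply/permP=> x; apply/ffunP=> i.
by rewrite permM !affE !ffunE mulrDr addrA mulrA addrA.
Qed.

Lemma aff1 : aff 0 1%g 0 = 1%g.
Proof.
apply/permP=> x; apply/ffunP=> i.
by rewrite affE perm1 !ffunE mul1r !addr0.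
Qed.

Definition delta i (c : F) : {ffun I -> F} := [ffun l => if l == i then c else 0].

(** The value at 0 gives b; the value at coordinate i of the indicator of i + k
    is then nonzero only if the shifts agree, and it gives a i. *)
Lemma aff_inj b a k b' a' k' :
  aff b a k = aff b' a' k' -> [/\ b = b', a = a' & k = k'].
Proof.
move=> eqf; have {}eqf x i : aff b a k x i = aff b' a' k' x i by rewrite eqf.
have eqb : b = b'.
  by apply/ffunP=> i; have:= eqf 0 i; rewrite !affE !ffunE !mulr0 !add0r.
have nz i : FinRing.uval (a i) != 0 by rewrite -unitfE; apply: valP.
have eqk i : FinRing.uval (a i) = FinRing.uval (a' i) /\ k = k'.
  have:= eqf (delta (i + k) 1) i.
  rewrite !affE !ffunE eqb eqxx mulr1 (inj_eq (addrI i)) => /addIr.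
  by case: eqP => [->|_]; rewrite ?mulr1 // mulr0 => /eqP; rewrite (negPf (nz i)).
split=> //; last by case: (eqk 0).
by apply/ffunP=> i; apply/val_inj; case: (eqk i).
Qed.

(** The wreath product of the affine group of the line F by I acting regularly
    on itself. *)
Definition aff_set := [set aff u.1.1 u.1.2 u.2 |
  u : {ffun I -> F} * {ffun I -> {unit F}} * I].
Definition tr_set := [set aff b 1%g 0 | b : {ffun I -> F}].
Definition diag_set := [set aff 0 a 0 | a : {ffun I -> {unit F}}].

Lemma aff_setP g : reflect (exists b a k, g = aff b a k) (g \in aff_set).
Proof.
apply: (iffP imsetP) => [[[[b a] k] _ ->]|[b [a [k ->]]]]; first by exists b, a, k.
by exists (b, a, k).
Qed.

Lemma mem_tr b : aff b 1%g 0 \in tr_set. Proof. exact: imset_f. Qed.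

Lemma trM b b' : (aff b 1 0 * aff b' 1 0)%g = aff (b + b') 1%g 0.
Proof.
rewrite affM; congr aff; last by rewrite addr0.
  by apply/ffunP=> i; rewrite !ffunE mul1r addr0.
by apply/ffunP=> i; rewrite !ffunE mulg1.
Qed.

Lemma group_set_aff : group_set aff_set.
Proof.
apply/group_setP; split; first by apply/aff_setP; exists 0, 1%g, 0; rewrite aff1.
move=> _ _ /aff_setP[b [a [k ->]]] /aff_setP[b' [a' [k' ->]]].
by rewrite affM; apply/aff_setP; do 3!eexists.
Qed.
Canonical aff_group := Group group_set_aff.

Lemma group_set_tr : group_set tr_set.
Proof.
apply/group_setP; split; first by apply/imsetP; exists 0; rewrite ?aff1.
by move=> _ _ /imsetP[b _ ->] /imsetP[b' _ ->]; rewrite trM mem_tr.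
Qed.
Canonical tr_group := Group group_set_tr.

Lemma group_set_diag : group_set diag_set.
Proof.
apply/group_setP; split; first by apply/imsetP; exists 1%g; rewrite ?aff1.
move=> _ _ /imsetP[a _ ->] /imsetP[a' _ ->]; rewrite affM.
apply/imsetP; exists [ffun i => a' i * a (i + 0)]%g => //; congr aff; rewrite ?addr0 //.
by apply/ffunP=> i; rewrite !ffunE mulr0 addr0.
Qed.
Canonical diag_group := Group group_set_diag.

Lemma card_aff_group :
  #|aff_group| = (#|F| ^ #|I| * (#|F|.-1 ^ #|I| * #|I|))%N.
Proof.
rewrite card_imset => [|[[b a] k] [[b' a'] k'] /= /aff_inj[-> -> ->]] //.
by rewrite !card_prod !card_ffun -card_finField_unit cardsT mulnA.
Qed.

Lemma card_tr_group : #|tr_group| = (#|F| ^ #|I|)%N.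
Proof. by rewrite card_imset ?card_ffun // => b b' /aff_inj[]. Qed.

Lemma card_diag_group : #|diag_group| = (#|F|.-1 ^ #|I|)%N.
Proof.
by rewrite card_imset ?card_ffun -?card_finField_unit ?cardsT // => a a' /aff_inj[].
Qed.

Lemma tr_group_abelian : abelian tr_group.
Proof.
apply/centsP=> _ /imsetP[b _ ->] _ /imsetP[b' _ ->].
by rewrite /commute !trM addrC.
Qed.

Lemma trJ b c a k :
  (aff c 1 0 ^ aff b a k)%g = aff [ffun i => FinRing.uval (a i) * c (i + k)] 1%g 0.
Proof.
apply: (mulgI (aff b a k)); rewrite -conjgC !affM; congr aff; last by rewrite addrC.
  by apply/ffunP=> i; rewrite !ffunE mul1r addr0 addrC.
by apply/ffunP=> i; rewrite !ffunE mulg1 mul1g addr0.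
Qed.

Lemma tr_normal : tr_group <| aff_group.
Proof.
apply/andP; split.
  by apply/subsetP=> _ /imsetP[b _ ->]; apply/aff_setP; exists b, 1%g, 0.
apply/subsetP=> _ /aff_setP[b [a [k ->]]]; rewrite inE.
apply/subsetP=> _ /imsetP[_ /imsetP[c _ ->] ->].
by rewrite trJ mem_tr.
Qed.

Lemma diag_sub : diag_group \subset aff_group.
Proof.
by apply/subsetP=> _ /imsetP[a _ ->]; apply/aff_setP; exists 0, a, 0.
Qed.

(** A permutation g commuting with all translations is determined by g 0: it is
    the translation by g 0. *)
Lemma cent_tr_group : 'C(tr_group) \subset tr_group.
Proof.
apply/subsetP=> g /centP cg; apply/imsetP; exists (g 0) => //.
apply/permP=> x; have := cg (aff x 1%g 0) (mem_tr x) => /permP/(_ 0).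
rewrite !permM.
have trE b y : aff b 1%g 0 y = y + b.
  by apply/ffunP=> i; rewrite affE !ffunE mul1r addr0.
by rewrite !trE add0r addrC => <-.
Qed.

(** This subgroup contains no coordinate axis but is a complement to each of
    them: a character trivial on it is determined by its restriction to any one
    axis, as [diag_inertia] exploits. *)
Definition tr0_set := [set aff b 1%g 0 | b : {ffun I -> F} & \sum_i b i == 0].

Lemma group_set_tr0 : group_set tr0_set.
Proof.
apply/group_setP; split.
  apply/imsetP; exists 0; rewrite ?aff1 // inE big1 // => i _.
  by rewrite ffunE.
move=> _ _ /imsetP[b /[!inE]/eqP b0 ->] /imsetP[b' /[!inE]/eqP b'0 ->].
rewrite trM; apply: imset_f; rewrite inE; apply/eqP.
by under eq_bigr do rewrite ffunE; rewrite big_split /= b0 b'0 addr0.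
Qed.
Canonical tr0_group := Group group_set_tr0.

Lemma sum_delta i c : \sum_l delta i c l = c.
Proof.
rewrite (bigD1 i) //= ffunE eqxx big1 ?addr0 // => l /negPf nli.
by rewrite ffunE nli.
Qed.

Lemma tr0_normal : tr0_group <| tr_group.
Proof.
rewrite -sub_abelian_normal ?tr_group_abelian //.
by apply/subsetP=> _ /imsetP[b _ ->]; rewrite mem_tr.
Qed.

Lemma tr0_proper : ~~ (tr_group \subset tr0_group).
Proof.
apply/subsetPn; exists (aff (delta 0 1) 1%g 0); first exact: mem_tr.
apply/imsetP=> [[b /[!inE]/eqP b0 /aff_inj[eb _ _]]].
by move/eqP: b0; rewrite -eb sum_delta oner_eq0.
Qed.

(** Modulo tr0_group, a translation by b equals the translation along axis i by
    the sum of the entries of b.  If a diagonal map a fixes 'chi_j and a i is not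
    1, then 'chi_j kills the translations along axis i by (a i - 1) d for all d,
    that is the whole axis, and hence all of tr_group. *)
Lemma diag_inertia (j : Iirr tr_group) :
  j != 0 -> tr0_group \subset cfker 'chi_j -> diag_group :&: 'I['chi_j] = 1%g.
Proof.
move=> nzj kj; apply/trivgP/subsetP=> _ /setIP[/imsetP[a _ ->] Ia].
have linj : 'chi_j \is a linear_char by apply/char_abelianP/tr_group_abelian.
pose u b := aff b 1%g 0; have Vu b : u b \in tr_group by apply: mem_tr.
have chiD b b' : 'chi_j (u (b + b')) = 'chi_j (u b) * 'chi_j (u b').
  by rewrite -lin_charM // /u trM.
have chi_sum b i : 'chi_j (u b) = 'chi_j (u (delta i (\sum_l b l))).
  rewrite -[b in LHS](subrK (delta i (\sum_l b l))) chiD.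
  rewrite (cfker1 (subsetP kj _ _)) ?lin_char1 ?mul1r //.
  apply/imsetP; exists (b - delta i (\sum_l b l)) => //; rewrite inE.
  rewrite (eq_bigr (fun l => b l - delta i (\sum_l b l) l)); last first.
    by move=> l _; rewrite !ffunE.
  by rewrite sumrB sum_delta subrr.
have nz b : 'chi_j (u b) != 0 by rewrite lin_char_neq0.
suff a1 : a = 1%g by rewrite a1 aff1 inE.
apply/ffunP=> i; rewrite ffunE; apply/val_inj/eqP.
apply: contraNT nzj; rewrite -subr_eq0 /= => nza.
rewrite -irr_eq1; apply/eqP/cfun_inP=> _ /imsetP[b _ ->].
rewrite cfun1E mem_tr // [LHS](chi_sum b i).
set c := \sum_l b l; pose d := (FinRing.uval (a i) - 1)^-1 * c.
have:= inertia_valJ (u (delta i d)) Ia; rewrite /u trJ -/(u _).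
have -> : [ffun l => FinRing.uval (a l) * delta i d (l + 0)] = delta i c + delta i d.
  apply/ffunP=> l; rewrite !ffunE addr0; case: eqP => [->|_]; last by rewrite mulr0 addr0.
  by rewrite -[c](mulVKf nza) -/d mulrBl mul1r subrK.
by rewrite chiD -{2}['chi_j (u (delta i d))]mul1r => /(mulIf (nz _)).
Qed.

End AffineWreath.

(** * Mersenne primes *)

Theorem theorem5 (p : nat) (hp : mersenne_prime p) :
  exists (gT : finGroupType) (G : {group gT}),
    [/\ solvable G,
        max_irr_degree G = p ^ p,
        #|G : 'O_p(G)|%g`_p = p ^ p.+1
      & ((#|G : 'O_p(G)|%g`_p)%N%:R
         = p.-1.-root ((max_irr_degree G)%:R ^+ p / p%:R) :> algC)%R].
Proof.
have [p_pr [f f_gt0 pE]] := hp; have p_gt0 := prime_gt0 p_pr.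
(* p = 2 is excluded because 2 ^ f is even. *)
have p_gt2 : 2 < p.
  have := prime_gt1 p_pr; rewrite leq_eqVlt pE => /predU1P[|//].
  by case: f f_gt0 {pE} => // f _; rewrite expnS; lia.
have [F _ oF] := pPrimePowerField (isT : prime 2) f_gt0.
have {}oF : #|F| = p.+1 by rewrite oF pE; lia.
have oI : #|'F_p| = p := card_Fp p_pr.
pose G := aff_group F 'F_p; pose V := tr_group F 'F_p; pose D := diag_group F 'F_p.
have nsVG : (V <| G)%g := tr_normal F 'F_p.
have abV : abelian V := tr_group_abelian F 'F_p.
have oV : #|V| = p.+1 ^ p by rewrite card_tr_group oF oI.
have oD : #|D| = p ^ p by rewrite card_diag_group oF oI.
have oG : #|G| = (p.+1 ^ p * p ^ p.+1)%N.
  by rewrite card_aff_group oF oI expnSr.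
have iGV : #|G : V|%g = p ^ p.+1.
  by rewrite -divgS ?normal_sub // oG oV mulKn ?expn_gt0.
have degG : max_irr_degree G = p ^ p.
  have [j nzj kj] := proper_sub_cfker_irr (tr0_normal F 'F_p) (tr0_proper F 'F_p).
  apply: (max_irr_degree_eq p_pr abV nsVG iGV _ (diag_sub F 'F_p) oD).
    by rewrite oV expSn_ltn.
  exact: diag_inertia nzj kj.
have iGO : #|G : 'O_p(G)|%g`_p = p ^ p.+1.
  have p'V : p^'.-group%g V.
    by rewrite /pgroup oV pnatX p'natE // -addn1 dvdn_addr // dvdn1 gtn_eqF ?prime_gt1.
  rewrite (pcore_self_centralizing nsVG p'V (cent_tr_group F 'F_p)) indexg1.
  rewrite -(Lagrange (normal_sub nsVG)) iGV partnM ?cardG_gt0 ?expn_gt0 ?p_gt0 //.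
  by rewrite part_p'nat // mul1n part_pnat_id // pnatX pnat_id.
exists _, G; split=> //.
  rewrite (series_sol nsVG) abelian_sol //=; apply: (@pgroup_sol _ p).
  by rewrite /pgroup card_quotient ?normal_norm // iGV pnatX pnat_id.
rewrite iGO degG; have p1_gt0 : 0 < p.-1 by lia.
have nz_p : (p%:R != 0 :> algC)%R by rewrite pnatr_eq0 -lt0n.
have -> : ((p ^ p)%:R ^+ p / p%:R = (p ^ p.+1)%:R ^+ p.-1 :> algC)%R.
  (* Both sides times p are p ^ (p * p), since (p + 1) (p - 1) + 1 = p * p. *)
  apply: (GRing.mulIf nz_p); rewrite GRing.mulfVK // -!GRing.natrX -GRing.natrM.
  rewrite -!expnM -expnSr.
  by congr (p ^ _)%:R%R; lia.
by rewrite exprCK // ler0n.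
Qed.
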